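(* There is an absolute constant $c>0$ such that for all sufficiently large integers $t$, \[ r(4,t) \;\geq\; c\,\frac{t^3}{\log^4 t}, \] i.e. $r(4,t)=\Omega\bigl(t^3/\log^4 t\bigr)$ as $t\to\infty$.
   Context: For integers $s,t\ge 2$, the Ramsey number $r(s,t)$ is the minimum $n$ such that every graph on $n$ vertices contains a clique of order $s$ or an independent set of order $t$. Logarithms are natural. *)

(* Defs.v *)
From mathcomp Require Import all_boot.
Set Implicit Arguments. Unset Strict Implicit. Unset Printing Implicit Defensive.

Definition simple_graph (n : nat) (e : rel 'I_n) : Prop :=
  (forall x, ~~ e x x) /\ (forall x y, e x y = e y x).

Definition is_clique (n : nat) (e : rel 'I_n) (A : {set 'I_n}) : Prop :=
  forall x y, x \in A -> y \in A -> x != y -> e x y.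

Definition is_indep (n : nat) (e : rel 'I_n) (A : {set 'I_n}) : Prop :=
  forall x y, x \in A -> y \in A -> ~~ e x y.

Definition ramsey_prop (s t n : nat) : Prop :=
  forall e : rel 'I_n, simple_graph e ->
    (exists A : {set 'I_n}, #|A| = s /\ is_clique e A) \/
    (exists A : {set 'I_n}, #|A| = t /\ is_indep e A).

(* Main.v *)
(* Mattheus and Verstraete's argument.  Let q = 2^k.  In the affine plane over
   the field with q^2 elements, the Hermitian unital has q^3 points, about q^4
   nonvertical secant lines with q+1 points each, and no four secants meeting
   pairwise in six distinct points (no O'Nan configuration).  Join two secants
   when they meet in a point of the unital, and at every point keep only the
   edges between the two classes of a random 2-colouring of the secants through
   it: the resulting graph has no K_4, since four pairwise meeting secants
   include three through one point, two of which share a colour there.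
   An exponential moment and a union bound give a colouring for which every set X
   of at least 8q^2 secants spans at least |X|^2/(64q) ordered edges, so that the
   Kleitman-Winston method bounds the number of independent t-sets by
   binom(N,r) binom(8q^2,t-r), with r about q log q.  For t of order q (log q)^2
   this is so small that some set of about t q^2 secants, i.e. of order
   t^3/(log t)^4, contains no independent t-set. *)
Require Import Defs.
From HB Require Import structures.
From mathcomp Require Import all_boot all_algebra all_field zify ring.
Set Implicit Arguments. Unset Strict Implicit. Unset Printing Implicit Defensive.
Import GRing.Theory.

Lemma leq_card_bigcup (V I : finType) (P : pred I) (A : I -> {set V}) :
  #|\bigcup_(i | P i) A i| <= \sum_(i | P i) #|A i|.
Proof.
elim/big_rec2: _ => [|i m B _ IH]; first by rewrite cards0.
by apply: leq_trans (leq_card_setU _ _) _; rewrite leq_add2l.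
Qed.

(** * Absence of O'Nan configurations *)

Section Onan.
Local Open Scope ring_scope.
Variables (F : fieldType) (s : {rmorphism F -> F}).
Hypothesis sK : involutive s.

(** The Hermitian form y z'^s + z y'^s - x x'^s in homogeneous coordinates, taken at z = z' = 1. Its
    isotropic points will form the unital. *)
Definition herm (P Q : F * F) : F := P.2 + s Q.2 - P.1 * s Q.1.

Lemma herm_conj P Q : s (herm P Q) = herm Q P.
Proof. by rewrite /herm rmorphB rmorphD rmorphM !sK; ring. Qed.

Definition det3 (A B C : F * F) : F :=
  (B.1 - A.1) * (C.2 - A.2) - (C.1 - A.1) * (B.2 - A.2).

(* The right-hand side is, up to sign, the Gram determinant of the form on
   [A, B, C]; its diagonal vanishes, so only two terms survive on the left. *)
Lemma herm_gram A B C : herm A A = 0 -> herm B B = 0 -> herm C C = 0 ->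
  herm B C * herm C A * herm A B + s (herm B C * herm C A * herm A B) =
  det3 A B C * s (det3 A B C).
Proof.
move=> hA hB hC; rewrite 2!rmorphM !herm_conj.
transitivity (herm B C * herm C A * herm A B + herm C B * herm A C * herm B A
   + herm A A * herm B B * herm C C - herm A A * herm B C * herm C B
   - herm B B * herm A C * herm C A - herm C C * herm A B * herm B A).
  by rewrite hA hB hC; ring.
by rewrite /herm /det3 !rmorphB !rmorphM !rmorphB; ring.
Qed.

(* The line [(a, b)] is [y = a x + b]. *)
Definition on_line (P l : F * F) : bool := P.2 == l.1 * P.1 + l.2.

Lemma on_lineE P l : on_line P l -> P.2 = l.1 * P.1 + l.2.
Proof. by move/eqP. Qed.

Lemma on_line_x P Q l : on_line P l -> on_line Q l -> P != Q -> P.1 - Q.1 != 0.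
Proof.
case: P Q => [x y] [x' y'] /eqP /= -> /eqP /= -> neq; rewrite subr_eq0.
by apply: contraNneq neq => ->.
Qed.

Lemma on_line_slope P l m : on_line P l -> on_line P m -> l != m ->
  l.1 - m.1 != 0.
Proof.
case: l m => [a b] [a' b'] /eqP /= e /eqP /= e' neq; rewrite subr_eq0.
by apply: contraNneq neq => ea; move: e'; rewrite e ea => /addrI ->.
Qed.

Lemma on_line_uniq P Q l m : on_line P l -> on_line P m -> on_line Q l ->
  on_line Q m -> l != m -> P = Q.
Proof.
move=> Pl Pm Ql Qm lm; apply/eqP/negPn/negP => PQ.
have := mulf_neq0 (on_line_slope Pl Pm lm) (on_line_x Pl Ql PQ).
rewrite (_ : _ * _ = (l.1 * P.1 + l.2) - (m.1 * P.1 + m.2)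
  - ((l.1 * Q.1 + l.2) - (m.1 * Q.1 + m.2))); last by ring.
by rewrite -(on_lineE Pl) -(on_lineE Pm) -(on_lineE Ql) -(on_lineE Qm) !subrr eqxx.
Qed.

(* In homogeneous coordinates [(xC - xB) D = (xC - xD) B + (xD - xB) C]; expand
   [herm D D = 0]. *)
Lemma herm_skew B C D l : herm B B = 0 -> herm C C = 0 -> herm D D = 0 ->
  on_line B l -> on_line C l -> on_line D l ->
  let w := (C.1 - D.1) * s (D.1 - B.1) * herm B C in s w = - w.
Proof.
move=> hB hC hD /on_lineE Bl /on_lineE Cl /on_lineE Dl w; apply/eqP.
rewrite -addr_eq0 /w 2!rmorphM herm_conj sK; apply/eqP.
transitivity ((C.1 - B.1) * s (C.1 - B.1) * herm D D
  - (C.1 - D.1) * s (C.1 - D.1) * herm B B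
  - (D.1 - B.1) * s (D.1 - B.1) * herm C C).
  by rewrite /herm Bl Cl Dl !(rmorphB, rmorphD, rmorphM); ring.
by rewrite hB hC hD; ring.
Qed.

(* Menelaus' theorem for the triangle [A B C] and the transversal [l4]. *)
Lemma menelaus (l1 l2 l3 l4 A B C D E G : F * F) :
  on_line B l1 -> on_line C l1 -> on_line D l1 ->
  on_line C l2 -> on_line A l2 -> on_line E l2 ->
  on_line A l3 -> on_line B l3 -> on_line G l3 ->
  on_line D l4 -> on_line E l4 -> on_line G l4 ->
  l1 != l4 -> l2 != l4 -> l3 != l4 ->
  (C.1 - D.1) * (A.1 - E.1) * (B.1 - G.1) =
  - ((D.1 - B.1) * (E.1 - C.1) * (G.1 - A.1)).
Proof.
move=> B1 C1 D1 C2 A2 E2 A3 B3 G3 D4 E4 G4 n1 n2 n3.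
have a1 := on_line_slope D1 D4 n1; have a2 := on_line_slope E2 E4 n2.
have a3 := on_line_slope G3 G4 n3.
(* Both sides are the vertical offset of the vertex [P] from [l4], computed along either side of the
   triangle through [P]. *)
have key P l m Q Q' : on_line P l -> on_line P m ->
  on_line Q l -> on_line Q l4 -> on_line Q' m -> on_line Q' l4 ->
  (l.1 - l4.1) * (P.1 - Q.1) = (m.1 - l4.1) * (P.1 - Q'.1).
  move=> /on_lineE Pl /on_lineE Pm /on_lineE Ql /on_lineE Q4 /on_lineE Ql' /on_lineE Q4'.
  transitivity (l.1 * P.1 + l.2 - l4.1 * P.1 - l4.2
    - (l.1 * Q.1 + l.2) + (l4.1 * Q.1 + l4.2)); first by ring.
  rewrite -Ql -Q4 -Pl Pm.
  transitivity (m.1 * P.1 + m.2 - l4.1 * P.1 - l4.2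
    - (m.1 * Q'.1 + m.2) + (l4.1 * Q'.1 + l4.2)); last by ring.
  by rewrite -Ql' -Q4'; ring.
apply: (mulfI (mulf_neq0 (mulf_neq0 a1 a2) a3)).
transitivity (((l1.1 - l4.1) * (C.1 - D.1)) * ((l2.1 - l4.1) * (A.1 - E.1)) *
  ((l3.1 - l4.1) * (B.1 - G.1))); first by ring.
rewrite (key C l1 l2 D E) // (key A l2 l3 E G) // (key B l3 l1 G D) //; ring.
Qed.

(* By [menelaus], multiplying the three instances of [herm_skew] shows that
   [h(B,C) h(C,A) h(A,B)] is skew; by [herm_gram] the triangle [A B C] is then
   degenerate. *)
Lemma no_onan (l1 l2 l3 l4 A B C D E G : F * F) :
  herm A A = 0 -> herm B B = 0 -> herm C C = 0 ->
  herm D D = 0 -> herm E E = 0 -> herm G G = 0 ->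
  on_line B l1 -> on_line C l1 -> on_line D l1 ->
  on_line C l2 -> on_line A l2 -> on_line E l2 ->
  on_line A l3 -> on_line B l3 -> on_line G l3 ->
  on_line D l4 -> on_line E l4 -> on_line G l4 ->
  l2 != l3 -> l1 != l4 -> l2 != l4 -> l3 != l4 ->
  A != B -> C != A -> C != D -> A != E -> B != G -> False.
Proof.
move=> hA hB hC hD hE hG B1 C1 D1 C2 A2 E2 A3 B3 G3 D4 E4 G4 n23 n1 n2 n3.
move=> AB CA CD AE BG.
have M := menelaus B1 C1 D1 C2 A2 E2 A3 B3 G3 D4 E4 G4 n1 n2 n3.
have w1 := herm_skew hB hC hD B1 C1 D1; have w2 := herm_skew hC hA hE C2 A2 E2.
have w3 := herm_skew hA hB hG A3 B3 G3.
move: w1 w2 w3 M; set p1 := C.1 - D.1; set p2 := A.1 - E.1; set p3 := B.1 - G.1.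
set q1 := D.1 - B.1; set q2 := E.1 - C.1; set q3 := G.1 - A.1.
set g1 := herm B C; set g2 := herm C A; set g3 := herm A B => w1 w2 w3 M.
have p0 : p1 * p2 * p3 != 0.
  by rewrite !mulf_neq0 // ?(on_line_x C1 D1 CD) ?(on_line_x A2 E2 AE)
     ?(on_line_x B3 G3 BG).
have sp0 : s (p1 * p2 * p3) != 0 by rewrite fmorph_eq0.
have sM : s p1 * s p2 * s p3 = - (s q1 * s q2 * s q3).
  by rewrite -!rmorphM M rmorphN.
have H0 : g1 * g2 * g3 + s (g1 * g2 * g3) = 0.
  apply: (mulfI (mulf_neq0 p0 sp0)); rewrite mulr0.
  have W : s ((p1 * s q1 * g1) * (p2 * s q2 * g2) * (p3 * s q3 * g3)) =
    - ((p1 * s q1 * g1) * (p2 * s q2 * g2) * (p3 * s q3 * g3)).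
    by rewrite 2!rmorphM w1 w2 w3; ring.
  move/eqP: W; rewrite -addr_eq0 => /eqP W.
  rewrite -[RHS]oppr0 -[in RHS]W !rmorphM !sK.
  transitivity (p1 * p2 * p3 * (s p1 * s p2 * s p3) * (g1 * g2 * g3) +
    p1 * p2 * p3 * (s p1 * s p2 * s p3) * (s g1 * s g2 * s g3)); first by ring.
  (* Menelaus enters conjugated in the first term and directly in the second. The terms become minus
     the skew product and minus its conjugate. *)
  rewrite {1}sM {2}M; ring.
have := herm_gram hA hB hC; rewrite -/g1 -/g2 -/g3 H0 => /esym/eqP.
rewrite mulf_eq0 fmorph_eq0 orbb; apply/negP.
(* Seen from [A], the determinant is, up to sign, the product of two horizontal steps and of the
   difference of the slopes of [l2] and [l3], all nonzero. *)
rewrite (_ : det3 A B C = (A.1 - B.1) * ((C.1 - A.1) * - (l2.1 - l3.1))).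
  by rewrite !(mulf_neq0, oppr_eq0) ?(on_line_x A3 B3) ?(on_line_x C2 A2)
    ?(on_line_slope A2 A3).
rewrite /det3 (_ : C.2 - A.2 = l2.1 * (C.1 - A.1)).
  rewrite (_ : B.2 - A.2 = l3.1 * (B.1 - A.1)); first by ring.
  by rewrite (on_lineE A3) (on_lineE B3); ring.
by rewrite (on_lineE A2) (on_lineE C2); ring.
Qed.

End Onan.

(** * The Hermitian unital *)

Lemma card_poly_roots (F : finFieldType) (p : {poly F}) n :
  size p = n.+1 -> #|[set x | root p x]| <= n.
Proof.
move=> sp; rewrite cardE -ltnS -sp max_poly_roots ?enum_uniq //.
  by rewrite -size_poly_eq0 sp.
by apply/allP => x; rewrite mem_enum inE.
Qed.

Lemma card_pairs_le (I J : finType) (A : pred (I * J)) n :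
  (forall x, #|[set y | A (x, y)]| <= n) -> #|A| <= #|I| * n.
Proof.
move=> h; rewrite -sum1_card.
have -> : \sum_(p in A) 1 = \sum_x \sum_(y | A (x, y)) 1.
  by rewrite pair_big_dep; apply: eq_bigl => -[].
rewrite -sum_nat_const; apply: leq_sum => x _.
by apply: leq_trans (h x); rewrite -sum1_card; apply/eq_leq/eq_bigl => y; rewrite inE.
Qed.

Definition partial_linear (P L : Type) (inc : P -> L -> bool) : Prop :=
  forall p p' l l', inc p l -> inc p l' -> inc p' l -> inc p' l' -> l <> l' -> p = p'.

(** Equivalent to forbidding six distinct intersection points: when two of them coincide, at least
    three of the lines pass through the common point. *)
Definition onan_free (P L : Type) (inc : P -> L -> bool) : Prop :=
  forall l : 'I_4 -> L, injective l ->
    (forall i j, i != j -> exists p, inc p (l i) && inc p (l j)) ->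
  exists i j k p, [/\ i != j, j != k & k != i] /\
    [/\ inc p (l i), inc p (l j) & inc p (l k)].

Section Hermitian.
Local Open Scope ring_scope.
Variables (F : finFieldType) (q : nat).
Hypotheses (cardF : #|F| = (q ^ 2)%N) (q2 : (1 < q)%N).
Hypothesis pcharq : [pchar F].-nat q.

Definition frob (x : F) : F := x ^+ q.

Lemma frob_add : zmod_morphism frob.
Proof.
move=> x y; rewrite /frob; apply: (addIr (y ^+ q)).
by rewrite -exprDn_pchar // !subrK.
Qed.

Lemma frob_mul : monoid_morphism frob.
Proof. by split=> [|x y]; rewrite /frob ?expr1n ?exprMn. Qed.

HB.instance Definition _ := GRing.isZmodMorphism.Build F F frob frob_add.
HB.instance Definition _ := GRing.isMonoidMorphism.Build F F frob frob_mul.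

Lemma frobK : involutive frob.
Proof. by move=> x; rewrite /frob -exprM mulnn -cardF expf_card. Qed.

Lemma card_pow_sub_le n (c : F) : (0 < n)%N -> (#|[set z : F | z ^+ n == c]| <= n)%N.
Proof.
move=> n0; apply: leq_trans (card_poly_roots (p := 'X^n - c%:P) _).
  by apply/subset_leq_card/subsetP => z; rewrite !inE /root !hornerE subr_eq0.
by rewrite size_XnsubC.
Qed.

(** A trace equation has degree [q]. This bounds both the unital points with a given abscissa and
    the tangents of a given slope. *)
Lemma card_trace_fiber_le (c : F) : (#|[set z : F | (z ^+ q + z)%R == c]| <= q)%N.
Proof.
apply: leq_trans (card_poly_roots (p := 'X^q + ('X - c%:P)) _).
  apply/subset_leq_card/subsetP => z.
  by rewrite !inE /root !hornerE subr_eq0.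
by rewrite size_polyDl size_polyXn // size_XsubC.
Qed.

(* The q^2-1 nonzero elements fall into at most q-1 fibres of the norm, each of
   size at most q+1, hence all of size q+1. *)
Lemma card_norm_fiber (c : F) : c != 0 -> frob c = c ->
  (q.+1 <= #|[set z : F | z ^+ q.+1 == c]|)%N.
Proof.
move=> c0 cq; pose K := [set d : F | d ^+ q.-1 == 1].
have KP (d : F) : d != 0 -> frob d = d -> d \in K.
  move=> d0 dq; rewrite inE -(inj_eq (mulfI d0)) -exprS prednK ?(ltnW q2) //.
  by rewrite mulr1 -/(frob d) dq.
have cK : c \in K by apply: KP.
have Kle : (#|K| <= q.-1)%N by apply: card_pow_sub_le; rewrite -ltnS prednK // ltnW.
have : (#|[set~ (0 : F)%R]| <= \sum_(d in K) #|[set z : F | z ^+ q.+1 == d]|)%N.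
  apply: leq_trans (leq_card_bigcup _ _); apply/subset_leq_card/subsetP => z.
  rewrite !inE => z0; apply/bigcupP; exists (z ^+ q.+1); last by rewrite inE.
  apply: KP; first by rewrite expf_neq0.
  by rewrite exprSr rmorphM /= -/(frob z) frobK mulrC.
rewrite cardsC1 cardF (bigD1 c) //=.
have : (\sum_(d in K | d != c) #|[set z : F | z ^+ q.+1 == d]| <= (q - 2) * q.+1)%N.
  apply: leq_trans (_ : \sum_(d in K | d != c) q.+1 <= _)%N.
    by apply: leq_sum => d _; apply: card_pow_sub_le.
  rewrite (eq_bigl (mem (K :\ c))) => [|d]; last by rewrite !inE andbC.
  rewrite sum_nat_const leq_mul2r; move: Kle; rewrite (cardsD1 c K) cK; lia.
(* The fibre over [c] gets what is left: q^2 - 1 - (q - 2)(q + 1) = q + 1. *)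
rewrite -(subnK q2); set m := (q - 2)%N; set S := (\sum_(_ in _ | _) _)%N.
rewrite !addn2 -mulnn; lia.
Qed.

Definition unital_point (p : F * F) : bool := herm frob p p == 0.
(* The line [y = a x + b] is tangent to the unital if and only if
   [Tr b + N a = 0]; see [card_secant_points]. *)
Definition secant_line (l : F * F) : bool := frob l.2 + l.2 + l.1 * frob l.1 != 0.
Definition unital_inc (p : {p | unital_point p}) (l : {l | secant_line l}) : bool :=
  on_line (val p) (val l).

Lemma frob_fix_norm x : frob (x * frob x) = x * frob x.
Proof. by rewrite rmorphM /= frobK mulrC. Qed.

Lemma card_unital : (#|{: {p | unital_point p}}| <= q ^ 3)%N.
Proof.
rewrite card_sig expnSr -cardF; apply: card_pairs_le => x.
apply: leq_trans (card_trace_fiber_le (x * frob x)).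
apply/subset_leq_card/subsetP => y; rewrite !inE /unital_point /herm /=.
by rewrite subr_eq0 addrC.
Qed.

Lemma card_secants : (q ^ 4 - q ^ 3 <= #|{: {l | secant_line l}}|)%N.
Proof.
rewrite card_sig leq_subLR.
have -> : (q ^ 4)%N = #|{: F * F}| by rewrite card_prod cardF -expnD.
rewrite -(cardC [pred l | secant_line l]) addnC leq_add2r.
rewrite expnSr -cardF; apply: card_pairs_le => a.
apply: leq_trans (card_trace_fiber_le (- (a * frob a))).
apply/subset_leq_card/subsetP => b; rewrite !inE /secant_line /= negbK.
by rewrite addr_eq0.
Qed.

Lemma card_secants_le : (#|{: {l | secant_line l}}| <= q ^ 4)%N.
Proof.
rewrite card_sig; apply: leq_trans (max_card _) _.
by rewrite card_prod cardF -expnD.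
Qed.

(* On the line [y = a x + b] the equation of the unital reads
   [N (x - frob a) = Tr b + N a]. *)
Lemma card_secant_points l : (q.+1 <= #|[set p | unital_inc p l]|)%N.
Proof.
case: l => [[a b] lP]; pose c := frob b + b + a * frob a; have c0 : c != 0 := lP.
have cq : frob c = c by rewrite /c !rmorphD /= frob_fix_norm frobK (addrC (frob b)).
apply: leq_trans (card_norm_fiber c0 cq) _.
pose g (z : F) := let x := z + frob a in (x, a * x + b).
have gI : injective g by move=> z z' [] /addIr.
rewrite -(card_imset _ gI).
rewrite -(card_imset [set p | unital_inc p _] val_inj).
apply/subset_leq_card/subsetP => p /imsetP[z]; rewrite inE => /eqP zc ->.
have gP : unital_point (g z).
  move: zc; rewrite exprS -/(frob z) /unital_point /herm /g /c /= => zc.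
  rewrite !rmorphD !rmorphM !rmorphD /= !frobK -[X in _ == X](subrr (z * frob z)).
  by rewrite {1}zc; apply/eqP; ring.
apply/imsetP; exists (exist _ (g z) gP) => //.
by rewrite inE /unital_inc /on_line /=.
Qed.

Lemma unital_partial_linear : partial_linear unital_inc.
Proof.
move=> p p' l l' pl pl' p'l p'l' ll'; apply: val_inj.
apply: (on_line_uniq pl pl' p'l p'l').
by apply/eqP => /val_inj.
Qed.

Lemma unital_onan_free : onan_free unital_inc.
Proof.
move=> l lI meet; pose i (n : nat) : 'I_4 := inord n.
have iE m n : (m < 4)%N -> (n < 4)%N -> m != n -> i m != i n.
  by move=> m4 n4; apply: contraNneq => /(congr1 (@nat_of_ord 4)); rewrite /i !inordK // => ->.
have lE m n : (m < 4)%N -> (n < 4)%N -> m != n -> val (l (i m)) != val (l (i n)).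
  by move=> m4 n4 /(iE _ _ m4 n4); apply: contraNneq => /val_inj/lI ->.
have [A /andP[A1 A2]] := meet (i 1%N) (i 2%N) (iE 1%N 2%N isT isT isT).
have [B /andP[B0 B2]] := meet (i 0%N) (i 2%N) (iE 0%N 2%N isT isT isT).
have [C /andP[C0 C1]] := meet (i 0%N) (i 1%N) (iE 0%N 1%N isT isT isT).
have [D /andP[D0 D3]] := meet (i 0%N) (i 3%N) (iE 0%N 3%N isT isT isT).
have [E /andP[E1 E3]] := meet (i 1%N) (i 3%N) (iE 1%N 3%N isT isT isT).
have [G /andP[G2 G3]] := meet (i 2%N) (i 3%N) (iE 2%N 3%N isT isT isT).
have three m n k p : (m < 4)%N -> (n < 4)%N -> (k < 4)%N ->
    [/\ m != n, n != k & k != m] ->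
    unital_inc p (l (i m)) -> unital_inc p (l (i n)) -> unital_inc p (l (i k)) ->
  exists i j k p, [/\ i != j, j != k & k != i] /\
    [/\ unital_inc p (l i), unital_inc p (l j) & unital_inc p (l k)].
  move=> m4 n4 k4 [mn nk km] pm pn pk; exists (i m), (i n), (i k), p.
  by split; split; rewrite ?iE.
have [AB|AB] := eqVneq A B; first by apply: (three 0 1 2 A)%N; rewrite // AB.
have [CA|CA] := eqVneq C A; first by apply: (three 0 1 2 C)%N; rewrite // CA.
have [CD|CD] := eqVneq C D; first by apply: (three 0 1 3 C)%N; rewrite // CD.
have [AE|AE] := eqVneq A E; first by apply: (three 1 2 3 A)%N; rewrite // AE.
have [BG|BG] := eqVneq B G; first by apply: (three 0 2 3 B)%N; rewrite // BG.
have hP (p : {p | unital_point p}) : herm frob (val p) (val p) = 0 by apply/eqP/(valP p).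
case: (no_onan frobK (hP A) (hP B) (hP C) (hP D) (hP E) (hP G) B0 C0 D0 C1 A1 E1
  A2 B2 G2 D3 E3 G3) => //; rewrite ?lE ?(inj_eq val_inj) //.
Qed.

End Hermitian.

Lemma unital_geometry k : 0 < k -> exists (P L : finType) (inc : P -> L -> bool),
  [/\ partial_linear inc, onan_free inc, #|P| <= (2 ^ k) ^ 3,
      (2 ^ k) ^ 4 - (2 ^ k) ^ 3 <= #|L| <= (2 ^ k) ^ 4 &
      forall l, 2 ^ k < #|[set p | inc p l]|].
Proof.
move=> k0; have k20 : 0 < k * 2 by rewrite muln_gt0 k0.
have [F pF cF] := pPrimePowerField (isT : prime 2) k20; rewrite expnM in cF.
have q1 : 1 < 2 ^ k by rewrite -{1}(expn0 2) ltn_exp2l.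
have pq : [pchar F]%R.-nat (2 ^ k) by rewrite pnatX pnatE // pF.
exists {p : F * F | unital_point pq p}, {l : F * F | secant_line (2 ^ k) l}.
exists (@unital_inc F (2 ^ k) pq); split.
- exact: unital_partial_linear.
- exact: unital_onan_free.
- exact: card_unital.
- by rewrite card_secants // card_secants_le.
- exact: card_secant_points.
Qed.

(** * Random bipartitions *)

(** Membership in [A] is an independent choice for each element, so the sum factors. *)
Lemma sum_expn_card (L : finType) (Y : {set L}) K :
  \sum_(A : {set L}) K ^ #|Y :&: A| = K.+1 ^ #|Y| * 2 ^ (#|L| - #|Y|).
Proof.
transitivity (\prod_(i : L) ((if i \in Y then K else 1) + 1)).
  rewrite bigA_distr; apply: eq_bigr => A _.
  rewrite -big_mkcond -big_mkcondr /=.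
  by rewrite prod_nat_const; congr (_ ^ _); apply: eq_card => i; rewrite !inE andbC.
rewrite (bigID (mem Y)) /=; congr (_ * _).
  rewrite (eq_bigr (fun=> K.+1)) => [|i ->]; last by rewrite addn1.
  by rewrite prod_nat_const.
rewrite (eq_bigr (fun=> 2)) => [|i /negbTE ->] //.
by rewrite prod_nat_const -(cardC (mem Y)) addKn; congr (_ ^ _); apply: eq_card.
Qed.

Definition minority (L : finType) (Y A : {set L}) := minn #|Y :&: A| #|Y :\: A|.

Lemma minorityE (L : finType) (Y A : {set L}) :
  minority Y A + maxn #|Y :&: A| #|Y :\: A| = #|Y|.
Proof. by rewrite /minority -(cardsID A Y); lia. Qed.

(** The maximum is replaced by the sum over both classes. Base 7 makes the factor per element of [Y]
    equal to 8, a power of 2. *)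
Lemma sum_expn_majority (L : finType) (Y : {set L}) :
  \sum_(A : {set L}) 7 ^ (#|Y| - minority Y A) <= 2 ^ (#|L|.+1 + 2 * #|Y|).
Proof.
apply: leq_trans (_ : \sum_(A : {set L}) (7 ^ #|Y :&: A| + 7 ^ #|Y :&: ~: A|) <= _).
  apply: leq_sum => A _; rewrite -(minorityE Y A) addKn -setDE /maxn.
  by case: ifP => _; rewrite ?leq_addl ?leq_addr.
have eC : \sum_(A : {set L}) 7 ^ #|Y :&: ~: A| = \sum_(A : {set L}) 7 ^ #|Y :&: A|.
  by rewrite [RHS](reindex_inj (@setC_inj L)).
rewrite big_split /= eC sum_expn_card.
have YL := max_card Y.
rewrite addnn -muln2 -[8]/(2 ^ 3) -expnM -expnD -expnSr leq_exp2l //.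
by move: YL; set a := #|Y|; set b := #|L|; lia.
Qed.

Lemma leq_sqr_sum (I : finType) (f : I -> nat) :
  (\sum_i f i) ^ 2 <= #|I| * \sum_i f i ^ 2.
Proof.
rewrite -(leq_pmul2l (isT : 0 < 2)) expnS expn1 big_distrlr /= big_distrr /=.
have -> : 2 * (#|I| * \sum_i f i ^ 2) = \sum_i \sum_j (f i ^ 2 + f j ^ 2).
  under [RHS]eq_bigr => i _ do rewrite big_split /= sum_nat_const.
  by rewrite big_split /= sum_nat_const -big_distrr /= mul2n addnn.
apply: leq_sum => i _; rewrite big_distrr; apply: leq_sum => j _ /=.
by rewrite (nat_Cauchy (f i) (f j)).1.
Qed.

Lemma leq_wexp2r e m n : m <= n -> m ^ e <= n ^ e.
Proof. by case: e => // e; rewrite leq_exp2r. Qed.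

Lemma ffact_le_exp n m : n ^_ m <= n ^ m.
Proof. by elim: m => // m IH; rewrite ffactnSr expnSr leq_mul ?leq_subr. Qed.

Lemma exp_le_ffact n m : (n - m) ^ m <= n ^_ m.
Proof.
elim: m => // m IH; rewrite ffactnSr expnSr leq_mul // ?leq_sub2l //.
by apply: leq_trans IH; rewrite leq_wexp2r ?leq_sub2l.
Qed.

Lemma leq_bin_exp n m : 'C(n, m) <= n ^ m.
Proof.
apply: leq_trans (ffact_le_exp n m); rewrite -bin_ffact.
by rewrite leq_pmulr ?fact_gt0.
Qed.

Lemma leq_bin_exp2 n m : 'C(n, m) <= 2 ^ n.
Proof.
elim: n m => [|n IH] [|m]; rewrite ?bin0 ?expn_gt0 //.
by rewrite binS expnS mul2n -addnn leq_add.
Qed.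

(** A weak Stirling bound: m^m <= (2m)(2m-1)...(m+1) = C(2m,m) m!. *)
Lemma leq_exp_fact m : m ^ m <= 4 ^ m * m`!.
Proof.
apply: leq_trans (_ : (m + m) ^_ m <= _).
  by apply: leq_trans (exp_le_ffact _ _); rewrite addnK.
by rewrite -bin_ffact leq_mul2r -[4]/(2 ^ 2) -expnM mul2n -addnn leq_bin_exp2 orbT.
Qed.

Section Coloring.
Variables (P L : finType) (inc : P -> L -> bool).
Implicit Types (X : {set L}) (c : {ffun P -> {set L}}).

Definition block p : {set L} := [set l | inc p l].

(** A colouring gives each point a subset of the whole of [L], which keeps the colourings a plain
    product space; only the trace on the block matters. *)
Definition minority_sum X c := \sum_p minority (X :&: block p) (c p).

Definition bad_colorings X : {set {ffun P -> {set L}}} :=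
  [set c | 8 * minority_sum X c < \sum_p #|X :&: block p|].

Lemma expn_bad_le X c n : c \in bad_colorings X -> 4 * n <= \sum_p #|X :&: block p| ->
  2 ^ (2 * (\sum_p #|X :&: block p|) + n) <=
  \prod_p 7 ^ (#|X :&: block p| - minority (X :&: block p) (c p)).
Proof.
rewrite inE -expn_sum /minority_sum; set T := (\sum_p #|_|) => bad nT.
set S := (\sum_p (_ - _)); have ST : S + minority_sum X c = T.
  rewrite -big_split; apply: eq_bigr => p _ /=.
  by rewrite subnK // -[leqRHS](minorityE _ (c p)) leq_addr.
(* Fourth powers allow 7^4 = 2401 >= 2^11. With S > 7T/8 this suffices: 11 S > 9 T >= 4 (2T + n). *)
rewrite -(leq_exp2r _ _ (isT : 0 < 4)) -!expnM.
apply: leq_trans (_ : 2 ^ (11 * S) <= _).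
  by rewrite leq_exp2l //; move: ST; rewrite /minority_sum; lia.
by rewrite [S * 4]mulnC !expnM leq_wexp2r.
Qed.

(* Markov's inequality for the product over the points of the weights
   [7 ^ majority], whose mean is at most [2 * 4 ^ #|Y|] on a block [Y]. *)
Lemma card_bad_colorings X n : 4 * n <= \sum_p #|X :&: block p| ->
  #|bad_colorings X| * 2 ^ n <= 2 ^ (#|P| * #|L|.+1).
Proof.
move=> nT; set T := \sum_p _ in nT.
have T0 : 0 < 2 ^ (2 * T) by rewrite expn_gt0.
rewrite -(leq_pmul2r T0) -mulnA -!expnD [n + _]addnC.
rewrite -sum_nat_const.
apply: leq_trans (_ : \sum_(c : {ffun P -> {set L}}) \prod_p 7 ^ (#|X :&: block p| - minority (X :&: block p) (c p)) <= _).
  rewrite big_mkcond; apply: leq_sum => c _; case: ifP => // cb.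
  exact: expn_bad_le.
rewrite -(bigA_distr_bigA (fun p A => 7 ^ (#|X :&: block p| - minority (X :&: block p) A))).
apply: leq_trans (_ : \prod_p 2 ^ (#|L|.+1 + 2 * #|X :&: block p|) <= _).
  by apply: leq_prod => p _; apply: sum_expn_majority.
by rewrite -expn_sum big_split sum_nat_const /= -big_distrr.
Qed.

Lemma sum_card_block X d : (forall l, d <= #|[set p | inc p l]|) ->
  d * #|X| <= \sum_p #|X :&: block p|.
Proof.
move=> hd; have -> : \sum_p #|X :&: block p| = \sum_(l in X) #|[set p | inc p l]|.
  transitivity (\sum_p \sum_(l in X) (inc p l : nat)).
    apply: eq_bigr => p _; rewrite -sum1_card big_mkcond [RHS]big_mkcond.
    by apply: eq_bigr => l _; rewrite !inE; case: (l \in X); case: (inc p l).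
  rewrite exchange_big; apply: eq_bigr => l _ /=; rewrite -sum1_card big_mkcond [RHS]big_mkcond.
  by apply: eq_bigr => p _; rewrite inE; case: (inc p l).
by rewrite mulnC -sum_nat_const; apply: leq_sum.
Qed.

Lemma exists_balanced_coloring a d R :
  0 < R -> #|L| <= 2 ^ a -> (forall l, d <= #|[set p | inc p l]|) ->
  (forall m, R <= m -> 4 * (#|P| + (2 * a + 2) * m) <= d * m) ->
  exists c, forall X, R <= #|X| -> d * #|X| <= 8 * minority_sum X c.
Proof.
move=> R0 La hd hR.
pose B m := \bigcup_(X in [set X : {set L} | #|X| == m]) bad_colorings X.
(* Each size [m] may spoil a fraction 1/(2(|L|+1)) of the colourings, so all sizes together spoil at
   most half. Of the exponent (2a+2)m, a m pays for the choice of [X] and the rest for this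
   fraction. *)
have Bm m : R <= m -> #|B m| * (2 * #|L|.+1) <= 2 ^ (#|P| * #|L|).
  move=> Rm; have m0 := leq_trans R0 Rm.
  have bX X : #|X| == m ->
      #|bad_colorings X| * 2 ^ ((2 * a + 2) * m) <= 2 ^ (#|P| * #|L|).
    (* The extra 2^|P| absorbs the factor 2 lost at each point in [sum_expn_majority]. *)
    move/eqP=> Xm; have P0 : 0 < 2 ^ #|P| by rewrite expn_gt0.
    rewrite -(leq_pmul2r P0) -mulnA -!expnD -(mulnSr #|P|); apply: card_bad_colorings.
    by apply: leq_trans (sum_card_block _ hd); rewrite Xm addnC hR.
  have : #|B m| * 2 ^ ((2 * a + 2) * m) <= 'C(#|L|, m) * 2 ^ (#|P| * #|L|).
    apply: leq_trans (leq_mul (leq_card_bigcup _ _) (leqnn _)) _.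
    rewrite big_distrl /= -card_draws -sum_nat_const.
    by apply: leq_sum => X; rewrite inE; apply: bX.
  have Lm : 'C(#|L|, m) <= 2 ^ (a * m).
    by apply: leq_trans (leq_bin_exp _ _) _; rewrite expnM leq_exp2r.
  have Le : 2 * #|L|.+1 <= 2 ^ (a * m + 2 * m).
    apply: leq_trans (_ : 2 ^ (a + 2) <= _); last by rewrite leq_exp2l //; nia.
    by rewrite expnD; have : 0 < 2 ^ a; [rewrite expn_gt0 | lia].
  have -> : (2 * a + 2) * m = (a * m + 2 * m) + a * m by ring.
  rewrite expnD mulnA => h; have am0 : 0 < 2 ^ (a * m) by rewrite expn_gt0.
  rewrite -(leq_pmul2r am0) [X in _ <= X]mulnC.
  apply: leq_trans (leq_trans h _); last by rewrite leq_mul2r Lm orbT.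
  by rewrite leq_mul2r leq_mul2l Le !orbT.
pose Bad := \bigcup_(m < #|L|.+1 | R <= m) B m.
have : #|Bad| < 2 ^ (#|P| * #|L|).
  have L0 : 0 < 2 * #|L|.+1 by [].
  rewrite -(ltn_pmul2r L0); apply: leq_ltn_trans (leq_mul (leq_card_bigcup _ _) (leqnn _)) _.
  rewrite big_distrl /=; apply: leq_ltn_trans (_ : \sum_(m < #|L|.+1) 2 ^ (#|P| * #|L|) < _).
    by rewrite big_mkcond; apply: leq_sum => m _; case: ifP => // /Bm.
  rewrite sum_nat_const card_ord [ltnRHS]mulnC -mulnA.
  by rewrite ltn_Pmull // muln_gt0 expn_gt0.
have -> : 2 ^ (#|P| * #|L|) = #|{: {ffun P -> {set L}}}|.
  have cS : #|{: {set L}}| = 2 ^ #|L| by rewrite -(cardsT L) -card_powerset powersetT cardsT.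
  by rewrite card_ffun cS -expnM mulnC.
move=> ltB; have /subsetPn[c _ cB] : ~~ ([set: {ffun P -> {set L}}] \subset Bad).
  by apply/negP => /subset_leq_card; rewrite cardsT leqNgt ltB.
exists c => X RX; rewrite leqNgt; apply/negP => h; move/negP: cB; apply.
have XL : #|X| < #|L|.+1 by rewrite ltnS max_card.
apply/bigcupP; exists (Ordinal XL) => //; apply/bigcupP; exists X; rewrite ?inE //.
exact: leq_trans h (sum_card_block X hd).
Qed.

End Coloring.

(** * The graph of secants defined by a colouring *)

Section ColouredGraph.
Variables (P L : finType) (inc : P -> L -> bool) (c : {ffun P -> {set L}}).
Hypothesis lin : partial_linear inc.

Definition cgraph : rel L :=
  fun l m => [exists p, [&& inc p l, inc p m & (l \in c p) != (m \in c p)]].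

Lemma cgraph_sym : symmetric cgraph.
Proof. by move=> l m; apply: eq_existsb => p; rewrite eq_sym andbCA. Qed.

Lemma cgraph_irr : irreflexive cgraph.
Proof. by move=> l; apply/existsP => -[p]; rewrite eqxx !andbF. Qed.

Lemma cgraph_K4_free : onan_free inc ->
  forall f : 'I_4 -> L, ~ (forall i j, i != j -> cgraph (f i) (f j)).
Proof.
move=> onan f K4.
have fI : injective f.
  by move=> i j fij; apply: contraTeq isT => /K4; rewrite fij cgraph_irr.
have [|i [j [k [p [[ij jk ki] [pi pj pk]]]]]] := onan f fI.
  by move=> i j /K4/existsP[p /and3P[pi pj _]]; exists p; rewrite pi.
(* Two distinct lines meet only in [p], so the point witnessing their edge is [p] and their colours
   differ there. *)
have col i' j' : i' != j' -> inc p (f i') -> inc p (f j') ->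
    (f i' \in c p) != (f j' \in c p).
  move=> ij' pi' pj'; have /existsP[p' /and3P[pi2 pj2]] := K4 _ _ ij'.
  by rewrite (lin pi2 pj2 pi' pj') // => /fI ij2; rewrite ij2 eqxx in ij'.
have := col _ _ ij pi pj; have := col _ _ jk pj pk; have := col _ _ ki pk pi.
by do 3 case: (_ \in c p).
Qed.

(** Each point carries a complete bipartite graph between its two classes. By [lin] a pair of lines
    is crossed at one point at most, so these graphs share no edge. *)
Lemma cgraph_degree_sum (X : {set L}) :
  \sum_p minority (X :&: block inc p) (c p) ^ 2 <=
  \sum_(u in X) #|X :&: [set v | cgraph u v]|.
Proof.
pose cross p u v := [&& inc p u, inc p v, u \in c p & v \notin c p].
apply: leq_trans (_ : \sum_p \sum_(u in X) \sum_(v in X) cross p u v <= _).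
  apply: leq_sum => p _; set Y := X :&: block inc p.
  apply: leq_trans (_ : #|Y :&: c p| * #|Y :\: c p| <= _).
    by rewrite -mulnn leq_mul // ?geq_minl ?geq_minr.
  rewrite -sum_nat_const big_mkcond [leqRHS]big_mkcond; apply: leq_sum => u _ /=.
  rewrite !inE; case: (u \in X) => //=; case: ifP => //= /andP[pu cu].
  rewrite -sum1_card big_mkcond [leqRHS]big_mkcond; apply: leq_sum => v _ /=.
  rewrite !inE /cross pu cu /=.
  by case: (v \in X); case: (inc p v); case: (v \in c p).
rewrite exchange_big; apply: leq_sum => u _ /=; rewrite exchange_big /=.
rewrite -sum1_card big_mkcond [leqRHS]big_mkcond; apply: leq_sum => v _ /=.
rewrite !inE; case: (v \in X) => //=.
case: (pickP (fun p => cross p u v)) => [p pc|none]; last first.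
  by rewrite big1 // => p _; rewrite none.
have /and4P[pu pv cu cv] := pc.
have -> : cgraph u v by apply/existsP; exists p; rewrite pu pv cu (negbTE cv).
rewrite (bigD1 p) //= pc big1 // => p' pp'; apply/eqP; rewrite eqb0.
apply: contra pp' => /and4P[pu' pv' _ _]; apply/eqP.
by apply: (lin pu' pv' pu pv) => uv; rewrite uv (negbTE cv) in cu.
Qed.

(** Averaging: if all degrees inside [X] were below |X|/D, their sum S would satisfy D S < |X|^2.
    Cauchy-Schwarz over the points gives d^2 |X|^2 <= 64 |P| S <= d^2 D S, a contradiction. *)
Lemma cgraph_large_degree (X : {set L}) d D :
  X != set0 -> 0 < d -> 64 * #|P| <= d ^ 2 * D ->
  d * #|X| <= 8 * minority_sum inc X c ->
  exists2 u, u \in X & #|X| <= D * #|X :&: [set v | cgraph u v]|.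
Proof.
move=> X0 d0 PD hX; apply/exists_inP; apply: contraLR hX; rewrite negb_exists_in.
move/forall_inP=> small; rewrite -ltnNge -(ltn_exp2r _ _ (isT : 0 < 2)).
have cX : 0 < #|X| by rewrite card_gt0.
have small_sum : D * \sum_(u in X) #|X :&: [set v | cgraph u v]| < #|X| ^ 2.
  rewrite -mulnn -sum_nat_const big_distrr /=.
  have /set0Pn[u uX] := X0; rewrite (bigD1 u) //= [ltnRHS](bigD1 u) //= -addSn.
  rewrite leq_add //; first by rewrite ltnNge small.
  by apply: leq_sum => v /andP[vX _]; rewrite ltnW // ltnNge small.
have := leq_sqr_sum (fun p => minority (X :&: block inc p) (c p)).
rewrite -/(minority_sum inc X c) => cs; have ds := cgraph_degree_sum X.
move: small_sum cs PD ds cX; set S := (\sum_(u in X) _); set Q := \sum_p _.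
move: (minority_sum _ _ _) #|X| #|P| S Q => M x n S Q sS MQ nD QS x0.
rewrite !expnMn; apply: leq_ltn_trans (_ : 64 * (n * S) < _).
  by rewrite leq_mul2l /=; apply: leq_trans MQ _; rewrite leq_mul2l QS orbT.
apply: leq_ltn_trans (_ : d ^ 2 * (D * S) < _); last by rewrite ltn_pmul2l // expn_gt0 d0.
by rewrite mulnA [leqRHS]mulnA leq_mul2r nD orbT.
Qed.

End ColouredGraph.

(** * Counting independent sets *)

Section KW.
Variables (V : finType) (e : rel V).

Definition indep (I : {set V}) : bool :=
  [forall x in I, forall y in I, ~~ e x y].

Lemma indepP (I : {set V}) : reflect {in I &, forall x y, ~~ e x y} (indep I).
Proof.
apply: (iffP forall_inP) => [h x y xI yI|h x xI]; first by move/forall_inP: (h x xI); apply.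
by apply/forall_inP => y yI; apply: h.
Qed.

Lemma indepS (I J : {set V}) : I \subset J -> indep J -> indep I.
Proof. by move=> /subsetP s /indepP h; apply/indepP => x y /s xJ /s; apply: h. Qed.

Definition indeps (X : {set V}) t : {set {set V}} :=
  [set I : {set V} | [&& I \subset X, #|I| == t & indep I]].

Lemma leq_card_indeps_draws (X : {set V}) t : #|indeps X t| <= 'C(#|X|, t).
Proof.
rewrite -cards_draws; apply/subset_leq_card/subsetP => I.
by rewrite !inE => /and3P[-> ->].
Qed.

(** Split on whether [v] is in the set; if it is, removing [v] leaves an independent set avoiding
    [v] and its neighbours. *)
Lemma card_indepsS (X : {set V}) v t : v \in X ->
  #|indeps X t.+1| <= #|indeps (X :\ v) t.+1|
    + #|indeps ((X :\ v) :\: [set u | e v u]) t|.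
Proof.
move=> vX; rewrite -(cardsID [set I : {set V} | v \in I] (indeps X t.+1)) addnC.
apply: leq_add.
  apply/subset_leq_card/subsetP => I; rewrite !inE subsetD1.
  by case/andP=> vI /and3P[-> -> ->]; rewrite vI.
rewrite -(@card_in_imset _ _ (fun I : {set V} => I :\ v)).
  apply/subset_leq_card/subsetP => J /imsetP[I]; rewrite !inE.
  case/andP=> /and3P[IX /eqP It /indepP Ii] vI ->.
  have -> : #|I :\ v| == t by have := cardsD1 v I; rewrite vI It add1n => -[<-].
  rewrite (indepS (subsetDl _ _)) ?andbT; last exact/indepP.
  apply/subsetP => x; rewrite !inE => /andP[xv xI].
  by rewrite xv (subsetP IX _ xI) (Ii v x).
move=> I J; rewrite !inE => /andP[_ vI] /andP[_ vJ] eIJ.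
by rewrite -(setD1K vI) eIJ setD1K.
Qed.

Lemma bin_trinomial n t r : r <= t -> t <= n ->
  'C(n, t) * 'C(t, r) = 'C(n, r) * 'C(n - r, t - r).
Proof.
move=> rt tn; have f0 : 0 < r`! * (t - r)`! * (n - t)`!.
  by rewrite !muln_gt0 !fact_gt0.
have e1 := bin_fact tn; have e2 := bin_fact (leq_trans rt tn).
have e3 : 'C(n - r, t - r) * ((t - r)`! * (n - t)`!) = (n - r)`!.
  by rewrite -(@bin_fact (n - r) (t - r)) ?leq_sub2r // subnBA // subnK //; lia.
have e4 := bin_fact rt.
apply/eqP; rewrite -(eqn_pmul2r f0); apply/eqP; transitivity n`!.
  by rewrite -e1 -e4; ring.
by rewrite -e2 -e3; ring.
Qed.

Lemma leq_bin_mul n t r : r <= t -> 'C(n, t) <= 'C(n, r) * 'C(n - r, t - r).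
Proof.
move=> rt; case: (leqP t n) => [tn|nt]; last by rewrite bin_small.
by rewrite -bin_trinomial // leq_pmulr // bin_gt0.
Qed.

(* The Kleitman-Winston algorithm in recursive form: splitting on a vertex of
   large degree gives the recursion of Pascal's triangle. *)
Lemma card_indeps_bound R D :
  (forall X : {set V}, R <= #|X| -> exists2 v, v \in X &
    #|X| <= D * #|X :&: [set u | e v u]|) ->
  forall (X : {set V}) t r, r <= t -> #|X| * D.-1 ^ r <= R * D ^ r ->
    #|indeps X t| <= 'C(#|X|, r) * 'C(R, t - r).
Proof.
move=> hdeg X; have [n] := ubnP #|X|; elim: n X => // n IHn X ltXn t r rt hr.
case: (leqP #|X| R) => [XR|RX].
  apply: leq_trans (leq_card_indeps_draws _ _) _.
  apply: leq_trans (leq_bin_mul _ rt) _.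
  by rewrite leq_mul2l leq_bin2l ?orbT //; lia.
case: r rt hr => [|r] rt hr; first by move: hr; rewrite !expn0 !muln1; lia.
case: t rt => // t rt.
have [v vX dv] := hdeg X (ltnW RX).
have cX := cardsD1 v X; rewrite vX add1n in cX.
set Y := (X :\ v) :\: [set u | e v u].
have YX : #|Y| <= #|X :\ v| by apply/subset_leq_card/subsetDl.
have cY : #|Y| + #|X :&: [set u | e v u]| <= #|X|.
  rewrite -(cardsID [set u | e v u] X) addnC leq_add2l.
  by apply/subset_leq_card/setSD/subsetDl.
have D0 : 0 < D by case: (D) dv => //; rewrite mul0n; lia.
(* Selecting [v] shrinks the set by a factor (D - 1)/D, which uses up one of the [r] factors in
   [hr]. *)
have hY : D * #|Y| <= D.-1 * #|X| by nia.
apply: leq_trans (card_indepsS t vX) _.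
have -> : t.+1 - r.+1 = t - r by lia.
rewrite cX binS mulnDl; apply: leq_add.
  apply: (IHn _ _ t.+1 r.+1) => //; first by lia.
  by apply: leq_trans hr; rewrite leq_mul2r cX leqnSn orbT.
apply: leq_trans (IHn Y _ t r _ _) _ => //; first by lia.
  rewrite -(leq_pmul2l D0) mulnA; apply: leq_trans (_ : D.-1 * #|X| * D.-1 ^ r <= _).
    by rewrite leq_mul2r hY orbT.
  by move: hr; rewrite !expnS; lia.
by rewrite leq_mul2r leq_bin2l ?orbT.
Qed.

End KW.

(** * Sampling a vertex set without independent t-sets *)

Lemma card_supersets (V : finType) (I : {set V}) n :
  #|[set W : {set V} | (I \subset W) && (#|W| == n)]| <= 'C(#|V| - #|I|, n - #|I|).
Proof.
rewrite -(@card_in_imset _ _ (fun W : {set V} => W :\: I)).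
  rewrite -[#|V| - _]/(#|V| - #|I|) -cardsT -(cardsDS (subsetT I)) -cards_draws.
  apply/subset_leq_card/subsetP => J /imsetP[W]; rewrite !inE => /andP[IW /eqP <-] ->.
  by rewrite setSD ?subsetT //= cardsDS.
move=> W W'; rewrite !inE => /andP[IW _] /andP[IW' _] eW.
by rewrite -(setID W I) -(setID W' I) eW (setIidPr IW) (setIidPr IW').
Qed.

(** First moment: [h] says that a uniform n-set contains fewer than one independent t-set on
    average. The proof counts pairs I in W and compares by [bin_trinomial]. *)
Lemma exists_subset_indep_free (V : finType) (e : rel V) t n :
  t <= #|V| -> n <= #|V| ->
  #|indeps e setT t| * 'C(n, t) < 'C(#|V|, t) ->
  exists2 W : {set V}, #|W| = n &
    forall I : {set V}, I \subset W -> #|I| = t -> ~~ indep e I.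
Proof.
move=> tV nV h.
case: (pickP [pred W : {set V} | (#|W| == n) &&
   [forall I : {set V}, (I \subset W) && (#|I| == t) ==> ~~ indep e I]]) => [W|none].
  case/andP=> /eqP cW /forallP hW; exists W => // I IW cI.
  by move: (hW I); rewrite IW cI eqxx.
have noneW (W : {set V}) : #|W| = n -> exists2 I, I \in indeps e setT t & I \subset W.
  move=> Wn; move: (none W); rewrite /= Wn eqxx /= => /negbT.
  rewrite negb_forall => /existsP[I]; rewrite negb_imply negbK.
  by case/andP=> /andP[IW It] Ii; exists I; rewrite // inE subsetT It.
have tn : t <= n.
  have : 0 < #|[set W : {set V} | #|W| == n]| by rewrite card_draws bin_gt0.
  case/card_gt0P => W; rewrite inE => /eqP Wn; have [I] := noneW W Wn.
  by rewrite inE -Wn => /and3P[_ /eqP <- _] /subset_leq_card.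
have : 'C(#|V|, n) <= #|indeps e setT t| * 'C(#|V| - t, n - t).
  rewrite -card_draws -sum_nat_const.
  apply: leq_trans (_ : #|\bigcup_(I in indeps e setT t)
     [set W : {set V} | (I \subset W) && (#|W| == n)]| <= _).
    apply/subset_leq_card/subsetP => W; rewrite inE => Wn.
    have [I It IW] := noneW W (eqP Wn).
    by apply/bigcupP; exists I => //; rewrite inE IW.
  apply: leq_trans (leq_card_bigcup _ _) _; apply: leq_sum => I.
  by rewrite inE => /and3P[_ /eqP <- _]; apply: card_supersets.
have B0 : 0 < 'C(#|V| - t, n - t) by rewrite bin_gt0 leq_sub2r.
have B1 := bin_trinomial tn nV; have : 0 < 'C(n, t) by rewrite bin_gt0.
nia.
Qed.

Lemma not_ramsey_prop (V : finType) (e : rel V) t n :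
  symmetric e -> irreflexive e ->
  (forall f : 'I_4 -> V, ~ (forall i j, i != j -> e (f i) (f j))) ->
  t <= #|V| -> n <= #|V| ->
  #|indeps e setT t| * 'C(n, t) < 'C(#|V|, t) -> ~ ramsey_prop 4 t n.
Proof.
move=> se ie K4 tV nV h; have [W cW hW] := exists_subset_indep_free tV nV h.
pose f (i : 'I_n) : V := enum_val (cast_ord (esym cW) i).
have fI : injective f by move=> i j /enum_val_inj/cast_ord_inj.
case/(_ (fun i j => e (f i) (f j))).
- by split=> [x|x y]; [rewrite ie | rewrite se].
- case=> A [cA clA].
  apply: (K4 (fun i => f (enum_val (cast_ord (esym cA) i)))) => i j ij.
  apply: clA; rewrite ?enum_valP //; apply: contraNneq ij.
  by move/enum_val_inj/cast_ord_inj=> ->.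
case=> A [cA iA]; suff: indep e (f @: A).
  apply/negP/hW; last by rewrite card_imset.
  by apply/subsetP => _ /imsetP[i _ ->]; apply: enum_valP.
by apply/indepP => _ _ /imsetP[i iA' ->] /imsetP[j jA ->]; apply: iA.
Qed.

(** * Choice of the parameters *)

Lemma bernoulli_expn m e : m ^ e * (m + e) <= m.+1 ^ e * m.
Proof.
elim: e => [|e IH]; first by rewrite addn0.
have : m.+1 * (m ^ e * (m + e)) <= m.+1 * (m.+1 ^ e * m) by rewrite leq_mul2l IH orbT.
rewrite !expnS; move: (m ^ e) (m.+1 ^ e) => a b; nia.
Qed.

(** Bernoulli gives (1 - 1/D)^D <= 1/2, so [D * j] selections halve the vertex set [j] times. *)
Lemma halving D j : 1 < D -> D.-1 ^ (D * j) * 2 ^ j <= D ^ (D * j).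
Proof.
move=> D1; rewrite !expnM -expnMn leq_wexp2r //.
have := bernoulli_expn D.-1 D; rewrite prednK ?(ltnW D1) //.
have p0 : 0 < D.-1 by rewrite -ltnS prednK // ltnW.
move=> h; rewrite -(leq_pmul2r p0); apply: leq_trans h.
by rewrite -mulnA leq_mul2l; apply/orP; right; lia.
Qed.

(** With m = t - r, C(R,m) <= (4R/m)^m <= (8R/t)^t. Hence t! times the left side is at most
    (16Rn/t)^t < (N-t)^t <= t! C(N,t). *)
Lemma counting n N R r t :
  'C(N, r) <= 2 ^ t -> t <= 2 * (t - r) -> 0 < t <= 8 * R ->
  16 * R * n < t * (N - t) ->
  'C(N, r) * 'C(R, t - r) * 'C(n, t) < 'C(N, t).
Proof.
move=> hr ht /andP[t0 tR] hn; set m := t - r.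
have rt : r <= t by rewrite /m in ht; lia.
have hR : 'C(R, m) * t ^ t <= (8 * R) ^ t.
  have tE x : x ^ t = x ^ m * x ^ r by rewrite -expnD subnK.
  rewrite !tE mulnA leq_mul //.
    apply: leq_trans (_ : 'C(R, m) * (2 ^ m * (4 ^ m * m`!)) <= _).
      rewrite leq_mul2l; apply/orP; right.
      apply: leq_trans (_ : (2 * m) ^ m <= _); first by rewrite leq_wexp2r.
      by rewrite expnMn leq_mul2l leq_exp_fact orbT.
    have -> : 8 * R = 2 * (4 * R) by ring.
    rewrite !expnMn mulnCA leq_mul2l; apply/orP; right.
    rewrite mulnCA leq_mul2l; apply/orP; right.
    by rewrite bin_ffact ffact_le_exp.
  by rewrite leq_wexp2r.
have f0 : 0 < t ^ t * t`! by rewrite muln_gt0 expn_gt0 t0 fact_gt0.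
rewrite -(ltn_pmul2r f0).
apply: leq_ltn_trans (_ : (2 ^ t * (8 * R) ^ t) * n ^ t < _).
  have -> : 'C(N, r) * 'C(R, m) * 'C(n, t) * (t ^ t * t`!) =
     'C(N, r) * ('C(R, m) * t ^ t) * ('C(n, t) * t`!) by ring.
  by rewrite bin_ffact !leq_mul // ffact_le_exp.
have -> : 'C(N, t) * (t ^ t * t`!) = t ^ t * ('C(N, t) * t`!) by ring.
rewrite bin_ffact; apply: leq_trans (_ : t ^ t * (N - t) ^ t <= _).
  rewrite -!expnMn ltn_exp2r //; apply: leq_trans hn.
  by rewrite ltnS; apply/eq_leq; ring.
by rewrite leq_mul2l exp_le_ffact orbT.
Qed.

(** This is what brings t <= 4096 k^2 q under the upper limit 64 q^2 of [not_ramsey_unital], where q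
    = 2^k. *)
Lemma leq_64sqr_exp k : 13 < k -> 64 * k ^ 2 <= 2 ^ k.
Proof.
move=> k13; rewrite -(subnK k13); move: (k - 14) => j {k k13}.
elim: j => [|j IH]; first by rewrite add0n; vm_compute.
rewrite addSn [2 ^ _.+1]expnS; move: IH; rewrite !expnS !expn0.
move: (j + 14) (2 ^ _) (leq_addl j 14) => k e; nia.
Qed.

Lemma not_ramsey_unital k t n : 13 < k ->
  512 * k ^ 2 * 2 ^ k <= t -> t <= 64 * (2 ^ k) ^ 2 ->
  512 * n < t * (2 ^ k) ^ 2 -> ~ ramsey_prop 4 t n.
Proof.
move=> k13; have k0 : 0 < k by lia.
have := leq_64sqr_exp k13.
have [P [L [inc [lin onan cP /andP[cL cL'] deg]]]] := unital_geometry k0.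
set q := 2 ^ k in cP cL cL' deg * => kq tlo thi hn.
(* [R] is the size above which sets are balanced. With D = 64 q, r = D * 2k selections make 2k
   halvings, a factor q^2, which takes q^4 secants below [R]. *)
pose R := 8 * q ^ 2; pose r := 64 * q * (2 * k).
have q0 : 12544 <= q by apply: leq_trans kq; rewrite -[12544]/(64 * 14 ^ 2) leq_mul2l leq_sqr.
have R0 : 0 < R by rewrite /R; nia.
have [] := @exists_balanced_coloring P L inc (4 * k) q R.
- exact: R0.
- by rewrite mulnC expnM.
- by move=> l; apply/ltnW.
- move=> m Rm; rewrite mulnDr.
  (* Half of q m covers 4 q^3 because m >= 8 q^2; the other half covers 4 (8k + 2) m. *)
  have : 64 * k + 16 <= q by rewrite /q in kq *; nia.
  by rewrite /R in Rm; nia.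
move=> c hc; apply: (@not_ramsey_prop L (cgraph inc c)).
- exact: cgraph_sym.
- exact: cgraph_irr.
- exact: cgraph_K4_free.
- nia.
- nia.
have rE : 4 * k * r = 512 * k ^ 2 * q by rewrite /r; ring.
have rt : 4 * r <= t by apply: leq_trans tlo; rewrite -rE leq_mul2r leq_pmulr ?orbT.
apply: leq_ltn_trans (_ : 'C(#|L|, r) * 'C(R, t - r) * 'C(n, t) < _).
  rewrite leq_mul // -(cardsT L).
  apply: (@card_indeps_bound _ _ R (64 * q)).
  - move=> X RX; have X0 : 0 < #|X| := leq_trans R0 RX.
    apply: (@cgraph_large_degree _ _ inc c lin X q).
    + by rewrite -card_gt0.
    + by lia.
    + have -> : q ^ 2 * (64 * q) = 64 * q ^ 3 by ring.
      by rewrite leq_mul2l cP orbT.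
    + exact: hc.
  - by lia.
  - rewrite cardsT; have D1 : 1 < 64 * q by lia.
    have := halving (2 * k) D1; rewrite -/r [2 * k]mulnC expnM -/q => h.
    apply: leq_trans (leq_mul cL' (leqnn _)) _.
    have -> : q ^ 4 * (64 * q).-1 ^ r = q ^ 2 * ((64 * q).-1 ^ r * q ^ 2) by ring.
    by rewrite /R leq_mul // leq_pmull.
apply: counting.
- apply: leq_trans (leq_bin_exp _ _) _.
  apply: leq_trans (leq_wexp2r r (_ : _ <= 2 ^ (4 * k))) _.
    by rewrite mulnC expnM.
  by rewrite -expnM leq_exp2l // rE.
- by lia.
- by rewrite /R; apply/andP; split; nia.
(* Then 16 R n = 128 q^2 n < t q^4 / 4 <= t (N - t), with N the number of secants. *)
- have : q ^ 4 <= 4 * (#|L| - t) by nia.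
  rewrite /R; nia.
Qed.

Lemma exists_scale (f : nat -> nat) k0 t : (forall k, k <= f k) -> f k0 <= t ->
  exists2 k, k0 <= k & f k <= t < f k.+1.
Proof.
move=> fk ft.
have bnd k : f k <= t -> k <= t by apply: leq_trans.
case: (ex_maxnP (ex_intro (fun k => f k <= t) k0 ft) bnd) => k fkt kmax.
exists k; first exact: kmax.
by rewrite fkt ltnNge; apply/negP => /kmax; rewrite ltnn.
Qed.

Lemma ramsey_scale : exists t0, forall t n, t0 <= t -> ramsey_prop 4 t n ->
  exists k, [/\ 0 < k, 2 ^ k <= t, t <= 4096 * k ^ 2 * 2 ^ k &
    t * (2 ^ k) ^ 2 <= 512 * n].
Proof.
pose f k := 512 * k ^ 2 * 2 ^ k; exists (f 14) => t n ft ramsey.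
have fk k : k <= f k by rewrite /f; have := ltn_expl k (isT : 1 < 2); nia.
have [k k14 /andP[tlo thi]] := exists_scale fk ft.
have kq := leq_64sqr_exp k14.
(* Consecutive scales differ by a factor of at most 8, from (k+1)^2 <= 4 k^2 and the doubling of
   2^k. *)
have thi' : t <= 4096 * k ^ 2 * 2 ^ k.
  apply: leq_trans (ltnW thi) _; rewrite /f [2 ^ k.+1]expnS.
  have k2 : k.+1 ^ 2 <= 4 * k ^ 2 by rewrite -[4]/(2 ^ 2) -expnMn leq_sqr; lia.
  apply: leq_trans (_ : 512 * (4 * k ^ 2) * (2 * 2 ^ k) <= _).
    by rewrite leq_mul2r leq_mul2l k2 !orbT.
  by apply/eq_leq; ring.
have k0 : 0 < k by lia.
exists k; split=> //.
  by apply: leq_trans tlo; rewrite leq_pmull // muln_gt0 expn_gt0 k0.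
rewrite leqNgt; apply/negP => hn; apply: (not_ramsey_unital k14 tlo _ hn) => //.
by nia.
Qed.

(* Passage to real logarithms *)
From Stdlib Require Import Reals Lra.

Lemma INR_leq m n : (m <= n)%N -> (INR m <= INR n)%R.
Proof. by move/leP/le_INR. Qed.

Lemma INR_expn m n : INR (expn m n) = (INR m ^ n)%R.
Proof. by elim: n => // n IH; rewrite expnS mult_INR IH. Qed.

Lemma ln_ge_half k t : (expn 2 k <= t)%N -> (INR k / 2 <= ln (INR t))%R.
Proof.
move/INR_leq; rewrite INR_expn => kt.
have p2 : (0 < INR 2 ^ k)%R by apply: pow_lt; rewrite /=; lra.
apply: Rle_trans (_ : ln (INR 2 ^ k) <= _)%R; last first.
  by case: kt => [/(ln_increasing _ _ p2)/Rlt_le|->] //; right.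
rewrite ln_pow; last by rewrite /=; lra.
rewrite (_ : INR 2 = 2%R) //; apply: Rmult_le_compat_l; first exact: pos_INR.
by have := ln_lt_2; lra.
Qed.

(* r(4,t) >= c t^3 / (ln t)^4 is expressed as: every n with the Ramsey
   property for (4,t) (i.e. every candidate for the minimum r(4,t))
   is at least c t^3 / (ln t)^4. *)
Theorem theorem1 :
  exists c : R, (0 < c)%R /\
  exists t0 : nat, forall t : nat, (t0 <= t)%N ->
    forall n : nat, ramsey_prop 4 t n ->
      (c * (INR t ^ 3) / (ln (INR t)) ^ 4 <= INR n)%R.
Proof.
(* From n >= t q^2 / 2^9, q >= t / (2^12 k^2) and k <= 2 ln t, the exponents add up to 9 + 24 + 4 =
   37. *)
exists (/ 2 ^ 37)%R; split; first by apply: Rinv_0_lt_compat; apply: pow_lt; lra.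
have [t0 scale] := ramsey_scale; exists t0 => t tt0 n /(scale t n tt0).
case=> k [k0 kt /INR_leq thi /INR_leq hn].
have lnt := ln_ge_half kt; have kpos : (0 < INR k)%R by apply: lt_0_INR; apply/ltP.
move: thi hn; rewrite !mult_INR !INR_expn.
have -> : INR 4096 = 4096%R by rewrite INR_IZR_INZ.
have -> : INR 512 = 512%R by rewrite INR_IZR_INZ.
have q1 : (1 <= INR 2 ^ k)%R by apply: pow_R1_Rle; rewrite /=; lra.
have tpos := pos_INR t.
move: (INR 2 ^ k)%R (INR k) (INR t) (INR n) (ln (INR t)) lnt kpos q1 tpos => q x s m y.
move=> lnt x0 q1 s0 thi hn; have y0 : (0 < y)%R by lra.
have y4 : (0 < y ^ 4)%R by apply: pow_lt.
apply: (Rmult_le_reg_r (y ^ 4)) => //.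
rewrite /Rdiv Rmult_assoc Rinv_l; last by lra.
rewrite Rmult_1_r.
have xy : (x ^ 4 <= 16 * y ^ 4)%R.
  have h : (x ^ 4 <= (2 * y) ^ 4)%R by apply: pow_incr; lra.
  by move: h; rewrite Rpow_mult_distr; lra.
have s2 : (s ^ 2 <= (4096 * x ^ 2 * q) ^ 2)%R by apply: pow_incr; lra.
have m0 : (0 <= m)%R by nra.
apply: Rle_trans (_ : m * (x ^ 4 / 16) <= _)%R; last by apply: Rmult_le_compat_l; lra.
apply: Rle_trans (_ : s * q ^ 2 / 512 * (x ^ 4 / 16) <= _)%R; last first.
  by apply: Rmult_le_compat_r; [have := pow_lt x 4 x0; lra | lra].
apply: Rle_trans (_ : / 2 ^ 37 * (s * (4096 * x ^ 2 * q) ^ 2) <= _)%R; last by right; field.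
apply: Rmult_le_compat_l; first by apply: Rlt_le; apply: Rinv_0_lt_compat; apply: pow_lt; lra.
rewrite -[(s ^ 3)%R]/(s * s ^ 2)%R; exact: Rmult_le_compat_l.
Qed.
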